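(* Let $\Phi:\mathcal{P}(\mathbb{R})\to\mathbb{R}\cup\{+\infty\}$ be $\sigma(\mathcal{P},C_b)$-lower semicontinuous, convex and not identically equal to $+\infty$. Then: (a) $\Phi$ is not translation invariant, i.e. it does not satisfy $\Phi(T_mQ)=\Phi(Q)-m$ for all $Q\in\mathcal{P}(\mathbb{R})$ and $m\in\mathbb{R}$; (b) $\Phi$ is not cash sup-additive, i.e. it does not satisfy $\Phi(T_mQ)\le\Phi(Q)-m$ for all $Q\in\mathcal{P}(\mathbb{R})$ and $m\ge 0$; (c) $\liminf_{n\to\infty}\Phi(\delta_n)\ne-\infty$. In particular, for every continuous, bounded from below and strictly decreasing function $f:\mathbb{R}\to\mathbb{R}$, the certainty equivalent map $\Phi_f:\mathcal{P}(\mathbb{R})\to\mathbb{R}\cup\{+\infty\}$, $\Phi_f(P):=-f^{-1}\left(\int f\,dP\right)$, is not convex.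
   Context: $\mathcal{P}=\mathcal{P}(\mathbb{R})$ is the (convex) set of Borel probability measures on $\mathbb{R}$; convexity of $\Phi$ is with respect to convex combinations (mixtures) of measures. $\sigma(\mathcal{P},C_b)$ is the topology of weak convergence (against bounded continuous functions). $T_mP$ is defined by $T_mP(-\infty,x]=P(-\infty,x-m]$ for $x\in\mathbb{R}$. $\delta_x$ is the Dirac measure at $x$. In the definition of $\Phi_f$, $\Phi_f(P)=+\infty$ when $\int f\,dP=+\infty$. *)

(* Defs.v *)
From HB Require Import structures.
From mathcomp Require Import all_boot all_order all_algebra.
From mathcomp Require Import all_classical all_reals all_analysis.

Set Implicit Arguments.
Unset Strict Implicit.
Unset Printing Implicit Defensive.
Import Order.TTheory GRing.Theory Num.Theory.
Import numFieldNormedType.Exports.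
Local Open Scope classical_set_scope.
Local Open Scope ring_scope.

(* A [probability R R] is a function on all subsets of [R], and its values on
   non-Borel sets are unconstrained; [eq_lsc_Borel] below shows that weakly
   lower semicontinuous functionals do not see these values. *)

Section weak_convergence.
Variable R : realType.

Definition bounded_continuous : Type :=
  {g : R -> R | continuous g /\ bounded_fun g}.

(* The coarsest topology for which [P |-> \int g dP] is continuous for every
   bounded continuous [g]. *)
Definition weak_prob : Type :=
  sup_topology (fun g : bounded_continuous => Topological.class
    (initial_topology
      (fun P : probability R R => \int[P]_x (sval g x)))).

HB.instance Definition _ := Topological.on weak_prob.

Lemma eq_lsc_Borel (Phi : weak_prob -> \bar R) (P Q : probability R R) :
  lower_semicontinuous Phi ->
  (forall A : set R, measurable A -> P A = Q A) -> Phi P = Phi Q.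
Proof.
move=> lscPhi PQ.
have sub (P1 P2 : probability R R) (V : set weak_prob) : (forall A : set R, measurable A -> P1 A = P2 A) ->
    nbhs (P2 : weak_prob) V -> V P1.
  move=> P12 V2.
  have : globally [set (P1 : weak_prob)] --> (P2 : weak_prob).
    apply/cvg_sup => g U /=.
    rewrite (@nbhsE (initial_topology
      (fun P : probability R R => \int[P]_x (sval g x)))) /=.
    move=> [_ [[B oB <-] /= BP2] sBU].
    move=> _ ->; apply: sBU => /=.
    rewrite /Rintegral (eq_measure_integral P2)// => A mA _.
    exact: P12.
  by move=> /(_ _ V2); apply.
have le (P1 P2 : probability R R) : (forall A : set R, measurable A -> P1 A = P2 A) ->
    (Phi P2 <= Phi P1)%E.
  move=> P12.
  have lt a : (a%:E < Phi P2)%E -> (a%:E < Phi P1)%E.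
    by move=> /lscPhi[V V2]; apply; exact: sub V2.
  rewrite leNgt; apply/negP; case E1 : (Phi P1) => [r| |].
  - by move=> /lt; rewrite E1 ltxx.
  - by rewrite ltNge leey.
  - case E2 : (Phi P2) => [s| |] //.
      by have := lt (s - 1); rewrite E1 E2 lte_fin ltrBlDr ltrDl ltr01 => /(_ isT).
    by have := lt 0; rewrite E1 E2 ltry => /(_ isT).
by apply/eqP; rewrite eq_le !le// => A mA; rewrite PQ.
Qed.

End weak_convergence.

Section translation.
Variables (R : realType) (m : R) (P : probability R R).

Definition addr_fun (x : R) : R := x + m.

Lemma measurable_addr_fun : measurable_fun [set: R] addr_fun.
Proof. by apply: measurable_realfun.measurable_funD => //; exact: measurable_cst. Qed.

HB.instance Definition _ :=
  isMeasurableFun.Build _ _ _ _ addr_fun measurable_addr_fun.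

(* The law of [X + m] when [X] has law [P]; [translateE] gives its distribution
   function, which determines it on Borel sets. *)
Definition translate : probability R R := distribution P addr_fun.

Lemma translateE x : translate `]-oo, x]%classic = P `]-oo, x - m]%classic.
Proof.
rewrite /translate/= /distribution/pushforward; congr (P _).
by apply/seteqP; split => y; rewrite /= !in_itv/= lerBrDr.
Qed.

End translation.

Section mixture.
Variables (R : realType) (t : {i01 R}) (P Q : probability R R).

Definition mix : set R -> \bar R :=
  measure_add (mscale t%:num%:nng P) (mscale (1 - t%:num)%:nng Q).

HB.instance Definition _ := Measure.on mix.

Lemma mixE A :
  mix A = (t%:num%:E * P A + (1 - t%:num)%:E * Q A)%E.
Proof. by rewrite /mix measure_addE. Qed.

Lemma mix_setT : mix setT = 1%E.
Proof. by rewrite mixE !probability_setT !mule1 -EFinD addrC subrK. Qed.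

HB.instance Definition _ := Measure_isProbability.Build _ _ _ mix mix_setT.

Definition mixture : probability R R := mix.

End mixture.

Section functionals.
Variable R : realType.
Implicit Type Phi : probability R R -> \bar R.
Local Open Scope ereal_scope.

Definition convex_functional Phi := forall (t : {i01 R}) P Q,
  Phi (mixture t P Q) <= t%:num%:E * Phi P + (1 - t%:num)%:E * Phi Q.

Definition translation_invariant Phi := forall Q (m : R),
  Phi (translate m Q) = Phi Q - m%:E.

Definition cash_sup_additive Phi := forall Q (m : R), (0 <= m)%R ->
  Phi (translate m Q) <= Phi Q - m%:E.

(* For [f] continuous, strictly decreasing and bounded from below, a finite
   integral lies in the range of [f], where ['pinv_ _ setT f] is the inverse of
   [f], and the integral is never [-oo]. *)
Definition certainty_equivalent (f : R -> R) (P : probability R R) : \bar R :=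
  if \int[P]_x (f x)%:E is r%:E then (- 'pinv_(fun=> 0%R) setT f r)%:E else +oo.

End functionals.

(* Main.v *)
Require Import Defs.
From mathcomp Require Import all_boot all_order all_algebra.
From mathcomp Require Import all_classical all_reals all_analysis.
From mathcomp Require Import measurable_realfun ring lra.
Import Order.TTheory GRing.Theory Num.Theory.
Import numFieldNormedType.Exports.
Local Open Scope classical_set_scope.
Local Open Scope ring_scope.

(** Fix [P] with [Phi P] finite.  As [n] grows, the mixtures
    [1/n Q_n + (1 - 1/n) P] converge weakly to [P] whatever the measures [Q_n],
    so lower semicontinuity at [P] and convexity forbid [Phi Q_n] from
    decreasing to [-oo] linearly in [n]: [Phi] is bounded below on all
    probability measures.  Cash sup-additivity would drive [Phi] to [-oo] along
    the translates of [P], and the sequence of Dirac measures is a special case.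

    For [Phi_f], convexity along the segment from [\d_0] to [\d_x] at its
    midpoint reads [(f 0 + f x) / 2 <= f (x / 2)].  Letting [x] tend to
    infinity, [f 0 <= inf f], contradicting strict monotonicity. *)

Lemma ge0_integral_mixture {R : realType} (t : {i01 R}) (P Q : probability R R)
    (f : R -> \bar R) :
  (forall x, 0 <= f x)%E -> measurable_fun [set: R] f ->
  (\int[mixture t P Q]_x f x =
   t%:num%:E * \int[P]_x f x + (1 - t%:num)%:E * \int[Q]_x f x)%E.
Proof.
move=> f0 mf.
rewrite (@eq_measure_integral _ _ _ _ (measure_add (mscale t%:num%:nng P)
  (mscale (1 - t%:num)%:nng Q)))//.
by rewrite ge0_integral_measure_add// !ge0_integral_mscale.
Qed.

(** Integrability makes the integrals of [f^\+] and [f^\-] finite, so the identity for nonnegative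
    functions, applied to both parts, recombines by real arithmetic. *)
Lemma integral_mixture {R : realType} (t : {i01 R}) (P Q : probability R R)
    (f : R -> \bar R) :
  P.-integrable [set: R] f -> Q.-integrable [set: R] f ->
  (\int[mixture t P Q]_x f x =
   t%:num%:E * \int[P]_x f x + (1 - t%:num)%:E * \int[Q]_x f x)%E.
Proof.
move=> iP iQ; have mf := measurable_int _ iP.
rewrite [LHS]integralE !ge0_integral_mixture//; last first.
- exact: measurable_funepos.
- exact: measurable_funeneg.
rewrite [in RHS](integralE P) [in RHS](integralE Q).
have finp (m : probability R R) : m.-integrable setT f ->
    (\int[m]_x f^\+ x)%E \is a fin_num /\ (\int[m]_x f^\- x)%E \is a fin_num.
  by move=> im; split; [exact: integrable_pos_fin_num|exact: integrable_neg_fin_num].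
have [/fineK <- /fineK <-] := finp P iP; have [/fineK <- /fineK <-] := finp Q iQ.
rewrite -!(EFinM, EFinN, EFinD); congr _%:E; ring.
Qed.

(** Against a bounded continuous [g], the mixture deviates from [P] by [t n] times a difference of
    two integrals; these are bounded uniformly over all probability measures, so no condition on [Q]
    is required. *)
Lemma cvg_mixture {R : realType} (P : probability R R)
    (Q : nat -> probability R R) {t : nat -> {i01 R}} :
  (t n)%:num @[n --> \oo] --> (0 : R) ->
  (fun n => mixture (t n) (Q n) P : weak_prob R) @ \oo --> (P : weak_prob R).
Proof.
move=> t0; apply/cvg_sup => -[g [cg bg]].
pose I (m : probability R R) := \int[m]_x g x.
have mg : measurable_fun [set: R] g by exact: continuous_measurable_fun.
have ig (m : probability R R) : m.-integrable [set: R] (EFin \o g).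
  by apply: measurable_bounded_integrable => //; rewrite -ge0_fin_numE ?fin_num_measure.
have Imix n : I (mixture (t n) (Q n) P) = I P + (t n)%:num * (I (Q n) - I P).
  rewrite /I /Rintegral integral_mixture//.
  have fin (m : probability R R) : (\int[m]_x (g x)%:E)%E \is a fin_num.
    exact: integrable_fin_num (ig m).
  rewrite fineD ?fin_numM// !fineM//=; ring.
have [M gM] : exists M : R, forall m, `|I m| <= M.
  (* [bounded_fun] only provides bounds strictly above some [M], hence the choice of [|M| + 1]. *)
  have [M [_ /(_ (`|M| + 1))]] := bg; rewrite ltr_pwDr ?ler_norm// => /(_ isT) gM.
  exists (`|M| + 1) => m; apply: (le_trans (le_normr_Rintegral _ (ig m))) => //.
  have M1 : \int[m]_(x in [set: R]) cst (`|M| + 1) x = `|M| + 1.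
    rewrite -[RHS]mulr1 Rintegral_cst//; congr (_ * _).
    exact: (congr1 fine (probability_setT m)).
  rewrite -[leRHS]M1; apply: le_Rintegral => //.
  - exact: integrable_norm (ig m).
  - exact: finite_measure_integrable_cst.
have cI : I (mixture (t n) (Q n) P) @[n --> \oo] --> I P.
  rewrite -[X in _ --> X]addr0; under eq_fun do rewrite Imix.
  apply: cvgD; first exact: cvg_cst.
  apply: (@squeeze_cvgr _ _ _ _ (fun n => - ((t n)%:num * (M + M)))
                                (fun n => (t n)%:num * (M + M))).
  - apply: nearW => n; rewrite -ler_norml normrM (ger0_norm (x := (t n)%:num))//.
    by rewrite ler_wpM2l// (le_trans (ler_normB _ _))// lerD.
  - by rewrite -oppr0 -(mul0r (M + M)); apply: cvgN; exact: cvgMl.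
  - by rewrite -(mul0r (M + M)); exact: cvgMl.
move=> U /=.
(* Neighborhoods in the initial topology contain preimages of open sets of reals, so convergence of
   the integrals [cI] suffices. *)
rewrite (@nbhsE (initial_topology (fun m : probability R R => \int[m]_x g x)))/=.
move=> [_ [[B oB <-] /= BP sBU]].
have : nbhs (I P) B by exact: open_nbhs_nbhs.
by move=> /cI; apply: (@filterS _ \oo) => n BI; exact: sBU.
Qed.

Lemma lsc_convex_bounded_below {R : realType} {Phi : probability R R -> \bar R} :
  (forall P, Phi P != -oo%E) ->
  lower_semicontinuous (Phi : weak_prob R -> \bar R) ->
  convex_functional Phi ->
  (exists P, Phi P != +oo%E) ->
  exists c : R, forall Q, (c%:E <= Phi Q)%E.
Proof.
move=> PhiNy lscPhi cPhi [P Py].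
have [r Pr] : exists r, Phi P = r%:E.
  by move: (PhiNy P) Py; case: (Phi P) => // r; exists r.
apply: contrapT => /forallNP unb.
have /choice[Q QP] (n : nat) : exists Q, (Phi Q < (r - n.+1%:R)%:E)%E.
  by have /existsNP[Q /negP] := unb (r - n.+1%:R); rewrite -ltNge; exists Q.
(* The weight [1/(n+1)] turns the deficit [n+1] of [Phi (Q n)] into a drop of exactly 1, whatever
   [n] is. *)
pose t (n : nat) : {i01 R} :=
  Itv01 (eqbRL (invr_ge0 n.+1%:R) (ler0n _ _))
        (eqbRL (invf_le1 (ltr0Sn R n)) (ler1n R n.+1)).
have tE n : (t n)%:num = n.+1%:R^-1 :> R by [].
have /(cvg_mixture P Q) mixP : (t n)%:num @[n --> \oo] --> (0 : R).
  exact: cvg_harmonic.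
(* Lower semicontinuity keeps [Phi] above [r - 1] near [P], while convexity will put the mixtures at
   or below [r - 1]. *)
have [V PV Vlt] : exists2 V, nbhs (P : weak_prob R) V &
    forall Q, V Q -> ((r - 1)%:E < Phi Q)%E.
  by apply: lscPhi; rewrite Pr lte_fin ltrBlDr ltrDl.
have [n /= Vn] : exists n, V (mixture (t n) (Q n) P).
  by have [n _ /(_ n (leqnn n))] := mixP _ PV; exists n.
have := lt_le_trans (Vlt _ Vn) (cPhi _ _ _).
rewrite Pr; have := QP n; case: (Phi (Q n)) (PhiNy (Q n)) => [s _| |]//.
rewrite lte_fin => sr; rewrite -!EFinM -EFinD lte_fin tE ltNge => /negP; apply.
have -> : r - 1 = n.+1%:R^-1 * (r - n.+1%:R) + (1 - n.+1%:R^-1) * r.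
  have : n.+1%:R != 0 :> R by rewrite pnatr_eq0.
  by move: n.+1%:R => k k0; field.
by rewrite lerD2r ler_wpM2l// ltW.
Qed.

Lemma bounded_below_not_cash_sup_additive {R : realType}
    {Phi : probability R R -> \bar R} {c : R} :
  (forall Q, (c%:E <= Phi Q)%E) -> (exists P, Phi P != +oo%E) ->
  ~ cash_sup_additive Phi.
Proof.
move=> cPhi [P Py] /(_ P) csa.
have := cPhi P; case: (Phi P) Py csa => [r _ csa| |]//; rewrite lee_fin => cr.
(* Translating by [r - c + 1] would bring [Phi] down to at most [c - 1], below its lower bound. *)
have m0 : 0 <= r - c + 1 by rewrite addr_ge0// subr_ge0.
have := le_trans (cPhi _) (csa _ m0); rewrite -EFinB lee_fin; lra.
Qed.

Section certainty_equivalent.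
Context {R : realType} (f : R -> R).
Hypothesis cf : continuous f.
Hypothesis f_decr : {homo f : x y / x < y >-> y < x}.

Lemma certainty_equivalentE {P : probability R R} {c} :
  (\int[P]_x (f x)%:E)%E = (f c)%:E ->
  certainty_equivalent f P = (- c)%:E.
Proof.
move=> Pc; rewrite /certainty_equivalent Pc pinvKV ?inE// => x y _ _ fxy.
by case: (ltgtP x y) => // /f_decr; rewrite fxy ltxx.
Qed.

Lemma integral_dirac_continuous a : (\int[\d_a]_x (f x)%:E)%E = (f a)%:E.
Proof.
rewrite integral_dirac//; last first.
  by apply/measurable_EFinP; exact: continuous_measurable_fun.
by rewrite diracT mul1e.
Qed.

Lemma integrable_dirac_continuous a :
  (\d_a : probability R R).-integrable [set: R] (EFin \o f).
Proof.
have mf : measurable_fun [set: R] f by exact: continuous_measurable_fun.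
apply/integrableP; split; first exact/measurable_EFinP.
rewrite integral_dirac//; last first.
  by apply/measurable_EFinP; exact: measurableT_comp.
by rewrite diracT mul1e ltry.
Qed.

Lemma certainty_equivalent_not_convex :
  has_lbound (range f) -> ~ convex_functional (certainty_equivalent f).
Proof.
move=> lbf cvx.
have f_nincr : {homo f : x y / x <= y >-> y <= x}.
  by move=> x y; rewrite le_eqVlt => /predU1P[->//|/f_decr/ltW].
have half0 : 0 <= 2^-1 :> R by lra.
have half1 : 2^-1 <= 1 :> R by lra.
have midpoint (x : R) : 0 <= x -> (f 0 + f x) / 2 <= f (x / 2).
  move=> x0; have fx0 := f_nincr _ _ x0.
  (* Here [- c] is the certainty equivalent of the mixture, so convexity reads [x / 2 <= c];
     applying [f] reverses it. *)
  have [c _ fc] : exists2 c, c \in `[0, x] & f c = (f 0 + f x) / 2.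
    apply: IVT => //; first exact: continuous_subspaceT.
    by rewrite min_r// max_l//; lra.
  have := cvx (Itv01 half0 half1) \d_(0 : R) \d_(x : R).
  rewrite (@certainty_equivalentE _ c); last first.
    rewrite integral_mixture; [|exact: integrable_dirac_continuous..].
    by rewrite !integral_dirac_continuous fc -!EFinM -EFinD/=; congr _%:E; lra.
  rewrite !(certainty_equivalentE (integral_dirac_continuous _)).
  rewrite -!EFinM -EFinD lee_fin/= => cx.
  by rewrite -fc; apply: f_nincr; lra.
have : (f 0 + inf (range f)) / 2 <= inf (range f).
  apply: lb_le_inf; first by exists (f 0), 0.
  move=> _ [y _ <-].
  (* The midpoint of 0 and [2 * |y|] is [|y|], which is at least [y]; this covers negative [y]
     too. *)
  have : (f 0 + f (2 * `|y|)) / 2 <= f y.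
    have := midpoint (2 * `|y|); rewrite mulrAC divff// mul1r.
    by move=> /(_ (mulr_ge0 _ _))/le_trans; apply => //; exact/f_nincr/ler_norm.
  have : inf (range f) <= f (2 * `|y|) by apply: ge_inf => //; exists (2 * `|y|).
  lra.
(* The previous bound gives [f 0 <= inf (range f) <= f 1], against [f 1 < f 0]. *)
have : inf (range f) <= f 1 by apply: ge_inf => //; exists 1.
have := f_decr 0 1 ltr01; lra.
Qed.

End certainty_equivalent.

Theorem corollary23 (R : realType) :
  (forall Phi : probability R R -> \bar R,
     (forall P, Phi P != -oo%E) ->
     lower_semicontinuous (Phi : weak_prob R -> \bar R) ->
     convex_functional Phi ->
     (exists P, Phi P != +oo%E) ->
     [/\ ~ translation_invariant Phi,
         ~ cash_sup_additive Phi &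
         limn_einf (fun n : nat => Phi \d_(n%:R : R)) != -oo%E]) /\
  (forall f : R -> R,
     continuous f ->
     has_lbound (range f) ->
     {homo f : x y / x < y >-> y < x} ->
     ~ convex_functional (certainty_equivalent f)).
Proof.
split=> [Phi PhiNy lscPhi cPhi PhiNpy|f cf lbf f_decr]; last first.
  exact: certainty_equivalent_not_convex.
have [c cle] := lsc_convex_bounded_below PhiNy lscPhi cPhi PhiNpy.
have ncsa := bounded_below_not_cash_sup_additive cle PhiNpy.
split=> // [tr|]; first by apply: ncsa => Q m _; rewrite tr.
(* The bound [c] passes to every tail infimum, hence to their limit. *)
rewrite -ltNye (@lt_le_trans _ _ c%:E) ?ltNyr// limn_einf_lim.
apply: lime_ge; first exact: is_cvg_einfs.
by apply: nearW => n; apply: le_ereal_inf_tmp => _ [k _ <-].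
Qed.
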